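(* Let $c_n\in\mathbb N$, $c_n\ge 2$ $(n\ge1)$, and let $S_{n,k}\ge 0$ be integers $(n\ge 1,\ 1\le k\le c_n)$. Let $(X,\mathcal B,m,T)$ be the rank one transformation (a conservative, ergodic, invertible measure preserving transformation) with construction data $$\{(c_n;S_{n,1},\dots,S_{n,c_n}):\ n\ge 1\}.$$ If $\sup_{n\ge 1}c_n<\infty$, then there exist constants $a_n>0$ $(n\ge1)$ such that for every $A\in\mathcal B$ with $0<m(A)<\infty$, $$\Sigma_n(1_A)(x)\ \asymp\ a_n\quad\text{for } m\text{-a.e. } x\in X .$$
   Context: For an invertible $T$, the two-sided (symmetric) Birkhoff sums are $\Sigma_n(f)(x):=\sum_{|k|<n}f(T^kx)$. For eventually positive sequences $a_n,b_n$, $a_n\asymp b_n$ means that there exists $M>1$ so that $M^{-1}<\frac{a_n}{b_n}<M$ for all large $n$. Rank one transformation with construction data $\{(c_n;S_{n,1},\dots,S_{n,c_n}):n\ge1\}$: put $C_n:=c_1\cdots c_n$ and $$S_T:=1+\sum_{n\ge 1}\frac1{C_n}\sum_{k=1}^{c_n}S_{n,k}\le\infty .$$ The transformation is an invertible piecewise translation of the interval $X=J_T=(0,S_T)$, equipped with its Borel sets $\mathcal B$ and Lebesgue measure $m$, defined (modulo null sets) as the limit of a nested sequence of Rokhlin towers $(\tau_n)_{n\ge1}$ of intervals. Each tower $\tau_n$ is an ordered list of pairwise disjoint intervals (levels) of equal length, and $T$ maps each level except the top one by translation onto the level directly above it. The first tower $\tau_1=[0,1]$ consists of a single level, and $\tau_{n+1}$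 is constructed from $\tau_n$ by: - cutting $\tau_n$ into $c_n$ columns of equal width (each level is cut into $c_n$ subintervals of equal length; the $k$-th column consists of the $k$-th subintervals of all levels); - putting $S_{n,k}$ spacer intervals (new disjoint intervals of $J_T$, of the same width as the column) above the $k$-th column, $1\le k\le c_n$; - stacking: placing the $(k+1)$-st column (with its spacers) on top of the $k$-th column with its spacers, $1\le k<c_n$. The levels of the towers exhaust $J_T$ modulo null sets. *)

(* Defs.v *)
From HB Require Import structures.
From mathcomp Require Import all_boot all_order all_algebra.
From mathcomp Require Import all_classical all_reals all_analysis.

Set Implicit Arguments.
Unset Strict Implicit.
Unset Printing Implicit Defensive.

Import Order.TTheory GRing.Theory Num.Theory.
Import numFieldNormedType.Exports.

Local Open Scope classical_set_scope.
Local Open Scope ring_scope.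

Definition iterz {X : Type} (T T' : X -> X) (k : int) (x : X) : X :=
  match k with
  | Posz n => iter n T x
  | Negz n => iter n.+1 T' x
  end.

(* The sum of f (T^k x) over the integers k with |k| < n, where T' is the
   inverse of T; k is written i - (n - 1) with 0 <= i < 2 n - 1, and the sum is
   empty for n = 0. *)
Definition symmetric_sum {R : realType} {X : Type} (T T' : X -> X) (n : nat)
    (f : X -> R) (x : X) : R :=
  \sum_(i < n.*2.-1) f (iterz T T' ((i : nat)%:Z - n.-1%:Z) x).

Definition asymp {R : realType} (a b : nat -> R) : Prop :=
  [/\ \forall n \near \oo, 0 < a n,
      \forall n \near \oo, 0 < b n &
      exists2 M : R, 1 < M & \forall n \near \oo, M^-1 < a n / b n < M].

(* The construction data (c_n; S_{n,1}, ..., S_{n,c_n}), n >= 1, are given by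
   c : nat -> nat and s : nat -> nat -> nat; only the values c n and s n k with
   1 <= n and 1 <= k <= c n are ever used. *)
Section RankOne.
Variables (R : realType) (c : nat -> nat) (s : nat -> nat -> nat).

Local Notation mu := (@lebesgue_measure R).

Definition cprod (n : nat) : nat := (\prod_(1 <= i < n.+1) c i)%N.

Definition total_length : \bar R :=
  (1 + \sum_(1 <= n <oo)
         ((cprod n)%:R^-1 * (\sum_(1 <= k < (c n).+1) s n k)%N%:R)%:E)%E.

Definition rank_one_space : set R :=
  [set x : R | 0 < x /\ (x%:E < total_length)%E].

(* The common width of the levels of the n-th tower is 1 / C_(n-1). *)
Definition width (n : nat) : R := (cprod n.-1)%:R^-1.

(* The n-th tower, n >= 1, is represented by the left endpoints of its levels,
   listed from bottom to top. [sp n k] lists, from bottom to top, the left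
   endpoints of the spacers put above the k-th column of the n-th tower. *)
Fixpoint tower (sp : nat -> nat -> seq R) (n : nat) : seq R :=
  match n with
  | 0 => [::]
  | 1 => [:: 0]
  | m.+1 => flatten [seq [seq a + k.-1%:R * width m.+1 | a <- tower sp m]
                           ++ sp m k | k <- iota 1 (c m)]
  end.

Definition base (sp : nat -> nat -> seq R) (n i : nat) : R :=
  nth 0 (tower sp n) i.

(* Levels are taken open; endpoints form a null set. *)
Definition level (sp : nat -> nat -> seq R) (n i : nat) : set R :=
  `]base sp n i, base sp n i + width n[%classic.

(* The placement of the spacers inside the space is left free, subject only to
   these conditions. *)
Record spacer_placement (sp : nat -> nat -> seq R) : Prop := SpacerPlacement {
  size_spacers : forall n k, (1 <= n)%N -> (1 <= k <= c n)%N ->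
    size (sp n k) = s n k;
  level_disjoint : forall n i j,
    (i < size (tower sp n))%N -> (j < size (tower sp n))%N -> i <> j ->
    level sp n i `&` level sp n j = set0;
  level_in_space : forall n i, (i < size (tower sp n))%N ->
    level sp n i `<=` rank_one_space;
  level_exhaust : {ae mu, forall x, rank_one_space x ->
    exists n i, (i < size (tower sp n))%N /\ level sp n i x}
}.

(* T is determined modulo null sets by [translates]: the intersection of the
   top levels of all towers from some point on is null because c n >= 2. The
   same towers show that T preserves Lebesgue measure. T' is the inverse of T
   modulo null sets. *)
Record rank_one (T T' : R -> R) (sp : nat -> nat -> seq R) : Prop := RankOne {
  spacersP : spacer_placement sp;
  measurable_T : measurable_fun rank_one_space T;
  measurable_T' : measurable_fun rank_one_space T';
  T_space : forall x, rank_one_space x -> rank_one_space (T x);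
  T'_space : forall x, rank_one_space x -> rank_one_space (T' x);
  T_invertible : {ae mu, forall x, rank_one_space x ->
    T' (T x) = x /\ T (T' x) = x};
  translates : forall n i, (i.+1 < size (tower sp n))%N ->
    {ae mu, forall x, level sp n i x ->
      T x = x + (base sp n i.+1 - base sp n i)}
}.

Definition rank_one_transformation (T T' : R -> R) : Prop :=
  exists sp : nat -> nat -> seq R, rank_one T T' sp.

End RankOne.

(* Main.v *)
Require Import Defs.
From HB Require Import structures.
From mathcomp Require Import all_boot all_order all_algebra.
From mathcomp Require Import all_classical all_reals all_analysis.
From mathcomp Require Import measurable_realfun zify lra ring.

Set Implicit Arguments.
Unset Strict Implicit.
Unset Printing Implicit Defensive.

Import Order.TTheory GRing.Theory Num.Theory.
Import numFieldNormedType.Exports.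

Local Open Scope classical_set_scope.
Local Open Scope ring_scope.

(** Write h_n for the height of the n-th tower, and C_n for [cprod n], so that
the n-th tower has levels of width 1 / C_(n-1), of which C_(n-1) make up the
interval J = (0, 1). The growth rate is a_N = C_(n-1) for h_n <= N < h_(n+1).

For A = J this is a matter of counting. If x lies in the n-th tower and
N >= h_n, the times |k| < N contain a full passage through that tower, hence at
least C_(n-1) visits to J ([symmetric_sum_unit_ge]). On the other hand, visits
to J occur only during passages through the (n+1)-st tower, which take h_(n+1)
steps and contain C_n visits each, so that fewer than 2 h_(n+1) consecutive
times contain at most 4 C_n visits ([symmetric_sum_unit_le]). As c_n is bounded,
C_n and C_(n-1) are comparable.

The passage from J to an arbitrary A rests on two facts. First, a maximal
inequality of Hopf type: for sets A and B, with A of finite measure, at almost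
every point x of B the symmetric sums of 1_A are at most a constant, depending
on x, times those of 1_B ([ae_symmetric_sum_dominated]). Applied to the pairs
A, J and J, A it yields the upper bound at almost every point of J and the lower
bound at almost every point of A. Secondly, ergodicity: almost every orbit
visits those points of J and of A ([ae_orbit_hits]). Moving along an orbit by k
steps turns sums over |j| < N into sums over |j| < N + |k| at most
([symmetric_sum_orbit]), which changes the relevant tower by at most one since
h_(n+1) >= 2 h_n.

Both facts are read off from the towers. At almost every point each finite
piece of the orbit lies inside one passage through a tall tower, where the
powers of T are translations between levels ([regular_point]). The maximal
inequality is an elementary statement on finite sequences ([window_maximal]),
integrated over the bottom level of a tower. Ergodicity follows from the
Lebesgue density theorem: two sets of positive measure each fill more than half
of some level of a common tower, and a power of T matches these levels. *)

(** * A maximal inequality for finite sequences *)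

(** Scan from left to right: a point outside E is skipped, and at a point of E
one jumps over its whole window, on which the sum of g is already paid for by
that of f. *)
Lemma forward_maximal (R : realDomainType) (f g : nat -> R) (h : nat)
    (E : pred nat) :
  (forall i, 0 <= f i) -> (forall i, 0 <= g i) ->
  (forall i, (i < h)%N -> E i -> exists2 e, (i < e <= h)%N &
     \sum_(i <= k < e) g k <= \sum_(i <= k < e) f k) ->
  \sum_(0 <= i < h | E i) g i <= \sum_(0 <= i < h) f i.
Proof.
move=> f0 g0 hE.
suff H n a : (a <= h)%N -> (h - a <= n)%N ->
    \sum_(a <= i < h | E i) g i <= \sum_(a <= i < h) f i.
  by apply: (H h 0%N); rewrite ?subn0.
elim: n a => [|n IH] a ah han.
  have -> : a = h by lia.
  by rewrite !big_geq.
have [->|neq] := eqVneq a h; first by rewrite !big_geq.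
have {neq} ltah : (a < h)%N by lia.
have [Ea|nEa] := boolP (E a); last first.
  rewrite big_ltn_cond // (negbTE nEa) (big_ltn ltah).
  rewrite (le_trans (IH a.+1 _ _)) ?lerDr //; lia.
have [e /andP[ae eh] le_e] := hE _ ltah Ea.
rewrite (@big_cat_nat _ _ _ e) ?(ltnW ae) //=.
rewrite [leRHS](@big_cat_nat _ _ _ e) ?(ltnW ae) //=.
apply: lerD; last by apply: IH => //; lia.
apply: le_trans le_e.
by rewrite big_mkcond; apply: ler_sum => i _; case: ifP.
Qed.

(** The mirror image of [forward_maximal] under i |-> h - 1 - i. *)
Lemma backward_maximal (R : realDomainType) (f g : nat -> R) (h : nat)
    (E : pred nat) :
  (forall i, 0 <= f i) -> (forall i, 0 <= g i) ->
  (forall i, (i < h)%N -> E i -> exists2 b, (b <= i)%N &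
     \sum_(b <= k < i.+1) g k <= \sum_(b <= k < i.+1) f k) ->
  \sum_(0 <= i < h | E i) g i <= \sum_(0 <= i < h) f i.
Proof.
move=> f0 g0 hE.
have rev (u : nat -> R) a b : (a <= b)%N -> (b <= h)%N ->
    \sum_(h - b <= k < h - a) u (h - k.+1)%N = \sum_(a <= k < b) u k.
  move=> ab bh.
  have shift m n (v : nat -> R) : \sum_(m <= k < n) v k
      = \sum_(0 <= k < n - m) v (k + m)%N by rewrite -{1}(add0n m) big_addn.
  rewrite [LHS]shift [RHS]shift (_ : (h - a - (h - b) = b - a)%N); last by lia.
  by rewrite big_nat_rev !big_nat; apply: eq_bigr => i /andP[_ ib]; congr u; lia.
have revE : \sum_(0 <= i < h | E (h - i.+1)%N) g (h - i.+1)%N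
    = \sum_(0 <= i < h | E i) g i.
  rewrite big_mkcond [RHS]big_mkcond /=.
  by rewrite -(rev (fun i => if E i then g i else 0) 0%N h) // subnn subn0.
have revf : \sum_(0 <= i < h) f (h - i.+1)%N = \sum_(0 <= i < h) f i.
  by rewrite -(rev f 0%N h) // subnn subn0.
rewrite -revE -revf; apply: forward_maximal => // i ih Ei.
have [|b bi le_b] := hE (h - i.+1)%N _ Ei; first by lia.
exists (h - b)%N; first by lia.
have -> : i = (h - (h - i.+1).+1)%N by lia.
by rewrite !rev //; lia.
Qed.

(** A window around i splits at i into a part ending at i and a part starting at
i, both containing i. If f dominates 2 g on the window, it dominates g on one
of the two parts, so E is covered by two sets to which the one-sided
inequalities apply; hence the two factors 2. *)
Lemma window_maximal (R : realDomainType) (f g : nat -> R) (h : nat)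
    (E : pred nat) :
  (forall i, 0 <= f i) -> (forall i, 0 <= g i) ->
  (forall i, (i < h)%N -> E i -> exists b e, [/\ (b <= i)%N, (i < e <= h)%N &
     2 * \sum_(b <= k < e) g k <= \sum_(b <= k < e) f k]) ->
  \sum_(0 <= i < h | E i) g i <= 2 * \sum_(0 <= i < h) f i.
Proof.
move=> f0 g0 hE.
pose fwd i := `[< exists2 e, (i < e <= h)%N &
  \sum_(i <= k < e) g k <= \sum_(i <= k < e) f k >].
pose bwd i := `[< exists2 b, (b <= i)%N &
  \sum_(b <= k < i.+1) g k <= \sum_(b <= k < i.+1) f k >].
have Ffwd : \sum_(0 <= i < h | fwd i) g i <= \sum_(0 <= i < h) f i.
  by apply: forward_maximal => // i _ /asboolP.
have Fbwd : \sum_(0 <= i < h | bwd i) g i <= \sum_(0 <= i < h) f i.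
  by apply: backward_maximal => // i _ /asboolP.
rewrite [leRHS]mulrDl !mul1r.
apply: le_trans (lerD Ffwd Fbwd).
rewrite !(big_mkcond _ g) -big_split /= !big_nat.
apply: ler_sum => i /andP[_ ih].
case: ifPn => [Ei|_]; last by apply: addr_ge0; case: ifP.
have [b [e [bi /andP[ie eh] le_be]]] := hE _ ih Ei.
have [/asboolP _|/asboolPn nfwd] := boolP (fwd i).
  by rewrite lerDl; case: ifP.
have [/asboolP _|/asboolPn nbwd] := boolP (bwd i).
  by rewrite lerDr.
exfalso.
have ltf : \sum_(i <= k < e) f k < \sum_(i <= k < e) g k.
  by rewrite ltNge; apply/negP => le; apply: nfwd; exists e => //; rewrite ie.
have ltb : \sum_(b <= k < i.+1) f k < \sum_(b <= k < i.+1) g k.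
  by rewrite ltNge; apply/negP => le; apply: nbwd; exists b.
move: le_be ltf ltb; rewrite !(@big_cat_nat _ _ _ i b e) ?(ltnW ie) //=.
rewrite !(big_nat_recr i b) //= !(big_ltn ie).
have f1 : 0 <= \sum_(i.+1 <= k < e) f k by apply: sumr_ge0.
have g1 : 0 <= \sum_(i.+1 <= k < e) g k by apply: sumr_ge0.
have f2 : 0 <= \sum_(b <= k < i) f k by apply: sumr_ge0.
have g2 : 0 <= \sum_(b <= k < i) g k by apply: sumr_ge0.
by move: (f0 i) (g0 i); lra.
Qed.

(** * Concatenations of a word and zeros *)

Inductive built_from (u : seq nat) : seq nat -> Prop :=
| built_nil : built_from u [::]
| built_copy l : built_from u l -> built_from u (u ++ l)
| built_zero l : built_from u l -> built_from u (0%N :: l).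

Lemma built_from_cat u l1 l2 :
  built_from u l1 -> built_from u l2 -> built_from u (l1 ++ l2).
Proof.
move=> h1 h2; elim: h1 => [//|l _ IH|l _ IH].
  by rewrite -catA; exact: built_copy.
exact: built_zero.
Qed.

Lemma built_from_nseq0 u n : built_from u (nseq n 0%N).
Proof.
by elim: n => [|n IH]; [exact: built_nil|exact: built_zero].
Qed.

Lemma built_from_flatten u (ls : seq (seq nat)) :
  (forall l, l \in ls -> built_from u l) -> built_from u (flatten ls).
Proof.
elim: ls => [_|l ls IH h]; first exact: built_nil.
apply: built_from_cat; first by apply: h; rewrite mem_head.
by apply: IH => l' l'ls; apply: h; rewrite inE l'ls orbT.
Qed.

Lemma built_from_self u : built_from u u.
Proof. by rewrite -[X in built_from _ X]cats0; apply/built_copy/built_nil. Qed.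

Lemma sumn_take_le m (l : seq nat) : (sumn (take m l) <= sumn l)%N.
Proof. by rewrite -{2}(cat_take_drop m l) sumn_cat leq_addr. Qed.

Lemma sumn_drop_le m (l : seq nat) : (sumn (drop m l) <= sumn l)%N.
Proof. by rewrite -{2}(cat_take_drop m l) sumn_cat leq_addl. Qed.

Lemma built_from_prefix u l m : built_from u l -> (m <= size u)%N ->
  (sumn (take m l) <= sumn u)%N.
Proof.
move=> hl; elim: hl m => [//|l' _ IH m mu|l' _ IH [//|m] mu] /=.
  by rewrite takel_cat // sumn_take_le.
by apply: IH; apply: ltnW.
Qed.

(** A window no longer than u meets at most two of the disjoint copies of u. *)
Lemma built_from_window u l a m : built_from u l -> (m <= size u)%N ->
  (sumn (take m (drop a l)) <= 2 * sumn u)%N.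
Proof.
move=> hl; elim: hl a m => [a m _|l' hl' IH a m mu|l' hl' IH [|a] m mu].
- by case: a.
- rewrite drop_cat; case: ltnP => au; last exact: IH.
  rewrite take_cat; case: ifP => _.
    apply: leq_trans (sumn_take_le _ _) _.
    by apply: leq_trans (sumn_drop_le _ _) _; lia.
  rewrite sumn_cat mul2n -addnn leq_add ?sumn_drop_le //.
  by apply: built_from_prefix => //; lia.
- rewrite drop0; apply: leq_trans (built_from_prefix _ mu) _; last by lia.
  exact: built_zero.
- exact: IH.
Qed.

Lemma sumn_window (l : seq nat) a b : (a <= b)%N ->
  (\sum_(a <= i < b) nth 0%N l i = sumn (take (b - a) (drop a l)))%N.
Proof.
move=> ab; rewrite -{1}(add0n a) big_addn.
elim: (b - a)%N => [|n IH]; first by rewrite big_geq // take0.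
rewrite big_nat_recr //= IH; have [lt|ge] := ltnP n (size (drop a l)).
  by rewrite (take_nth 0%N) // sumn_rcons nth_drop addnC addnC (addnC a).
rewrite !take_oversize //; last exact: leqW.
move: ge; rewrite size_drop => ge.
by rewrite nth_default ?addn0 //; lia.
Qed.

Lemma built_from_sum u l a b : built_from u l -> (b - a <= size u)%N ->
  (\sum_(a <= i < b) nth 0%N l i <= 2 * sumn u)%N.
Proof.
move=> hl bau; have [ab|/ltnW ba] := leqP a b; last by rewrite big_geq.
by rewrite sumn_window // built_from_window.
Qed.
(** * Lebesgue measure on the line *)

#[local] Instance ae_lebesgue_filter (R : realType) :
  Filter (nbhs (almost_everywhere (@lebesgue_measure R))).
Proof. exact: (ae_filter_ringOfSetsType (@lebesgue_measure R)). Qed.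

Lemma ae_null_set (R : realType) (P : R -> Prop) :
  {ae @lebesgue_measure R, forall x, P x} ->
  exists N : set R, [/\ measurable N, {ae @lebesgue_measure R, forall x, ~ N x} &
    forall x, ~ N x -> P x].
Proof.
move=> [N [mN N0 PN]]; exists N; split=> //; last first.
  by move=> x nNx; apply: contrapT => nPx; apply: nNx; exact: PN.
by exists N; split=> // x /= /contrapT.
Qed.

Section translation.
Variable R : realType.
Local Notation mu := (@lebesgue_measure R).

Lemma measurable_shift (d : R) : measurable_fun setT (fun x : R => x + d).
Proof. by apply: measurable_funD => //; exact: measurable_cst. Qed.

Lemma measurable_preimage_shift (d : R) (A : set R) :
  measurable A -> measurable [set x | A (x + d)].
Proof.
move=> mA; rewrite -[X in measurable X]setTI.
exact: (measurable_shift d measurableT mA).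
Qed.

Lemma lebesgue_measure_shift (d : R) (A : set R) :
  measurable A -> mu [set x | A (x + d)] = mu A.
Proof.
move=> mA.
have mf : measurable_fun setT ((fun x => x + d) : R -> measurableTypeR R).
  exact: measurable_shift.
pose nu := pushforward mu ((fun x => x + d) : R -> measurableTypeR R).
suff : mu A = nu A by move=> ->.
apply: lebesgue_measure_unique => //= _ [[a b]] _ <-.
rewrite /nu /pushforward.
have -> : (fun x : R => x + d) @^-1` `]a, b]%classic
   = `]a - d, b - d]%classic.
  by apply/seteqP; split => x /=; rewrite !in_itv /= ltrBlDr lerBrDr.
rewrite !lebesgue_measure_itv /= !lte_fin ltrD2r.
by case: ifP => // _; rewrite -!EFinD; congr EFin; ring.
Qed.

Lemma ae_shift (d : R) (P : R -> Prop) :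
  {ae mu, forall x, P x} -> {ae mu, forall x, P (x + d)}.
Proof.
move=> [N [mN N0 PN]]; exists [set x | N (x + d)]; split.
- exact: measurable_preimage_shift.
- by rewrite lebesgue_measure_shift.
- by move=> x /= nP; apply: PN.
Qed.

End translation.
(** A pointwise inequality between weighted counts of the sets containing a
point integrates to one between the measures of the sets. *)
Lemma sum_indic_measure_le d (X : measurableType d) (R : realType)
    (m : {measure set X -> \bar R}) (h : nat) (P Q : nat -> set X) (a b : R) :
  (forall i, measurable (P i)) -> (forall i, measurable (Q i)) ->
  0 <= a -> 0 <= b ->
  (forall t, a * \sum_(0 <= i < h) \1_(P i) t <= b * \sum_(0 <= i < h) \1_(Q i) t) ->
  (a%:E * \sum_(0 <= i < h) m (P i) <= b%:E * \sum_(0 <= i < h) m (Q i))%E.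
Proof.
move=> mP mQ a0 b0 PQ.
have E (V : nat -> set X) (r : R) : (forall i, measurable (V i)) -> 0 <= r ->
    (r%:E * \sum_(0 <= i < h) m (V i) =
     \int[m]_t (r * \sum_(0 <= i < h) \1_(V i) t)%:E)%E.
  move=> mV r0; under [RHS]eq_integral do rewrite EFinM -sumEFin.
  rewrite ge0_integralZl //; first last.
  - by move=> t _; apply: sume_ge0.
  - by apply: emeasurable_sum => i; apply/measurable_EFinP; exact: measurable_indic.
  rewrite ge0_integral_sum //; last first.
    by move=> i; apply/measurable_EFinP; exact: measurable_indic.
  congr (_ * _)%E; apply: eq_bigr => i _.
  by rewrite integral_indic // setIT.
have M (V : nat -> set X) (r : R) : (forall i, measurable (V i)) ->
    measurable_fun setT (fun t => (r * \sum_(0 <= i < h) \1_(V i) t)%:E).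
  move=> mV; apply/measurable_EFinP; apply: measurable_funM => //.
  by apply: measurable_sum => i; exact: measurable_indic.
rewrite !E //; apply: ge0_le_integral => //.
- by move=> t _; rewrite lee_fin mulr_ge0 // sumr_ge0.
- exact: M.
- exact: M.
- by move=> t _; rewrite lee_fin.
Qed.

(** Fatou's lemma for sets: the intersections of tails increase to the lower
limit. *)
Lemma measure_liminf_le d (X : measurableType d) (R : realType)
    (m : {measure set X -> \bar R}) (F : nat -> set X) (M : \bar R) :
  (forall n, measurable (F n)) -> (forall n, (m (F n) <= M)%E) ->
  (m (\bigcup_k \bigcap_(n >= k) F n) <= M)%E.
Proof.
move=> mF FM; pose G k := \bigcap_(n >= k) F n.
have mG k : measurable (G k).
  by apply: bigcap_measurable => [|n _]; [exists k => /=|exact: mF].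
have cvgG : m (G k) @[k --> \oo] --> m (\bigcup_k G k).
  apply: nondecreasing_cvg_mu => //; first exact: bigcup_measurable.
  move=> j k jk; apply/subsetPset => x Gx n /= kn; apply: Gx.
  exact: leq_trans jk kn.
rewrite -(cvg_lim _ cvgG) //; apply: lime_le.
  by apply/cvg_ex; eexists; exact: cvgG.
apply: nearW => k; apply: le_trans (FM k).
by apply: le_measure; rewrite ?inE // => x; apply => /=.
Qed.

(** * Combinatorics of the towers *)

Section tower.
Variables (R : realType) (c : nat -> nat) (s : nat -> nat -> nat).
Variable sp : nat -> nat -> seq R.
Hypothesis c_ge2 : forall n, (1 <= n)%N -> (2 <= c n)%N.
Hypothesis spP : spacer_placement c s sp.

Local Notation mu := (@lebesgue_measure R).
Local Notation width := (width R c).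
Local Notation base := (base c sp).
Local Notation level := (level c sp).
Local Notation unit_itv := (`]0, 1[%classic : set R).

Definition height n := size (tower c sp n).

(** The tower with each level paired with a mark, 1 for the levels cut out of
the initial interval (0, 1) and 0 for those cut out of spacers. Building both at
once makes the correspondence of indices between levels and marks automatic;
the list of marks is the symbolic itinerary of a passage through the tower. *)
Fixpoint marked_tower (n : nat) : seq (R * nat) :=
  match n with
  | 0 => [::]
  | 1 => [:: (0, 1%N)]
  | m.+1 => flatten
      [seq [seq (p.1 + k.-1%:R * width m.+1, p.2) | p <- marked_tower m]
         ++ [seq (a, 0%N) | a <- sp m k] | k <- iota 1 (c m)]
  end.

Definition marks n := unzip2 (marked_tower n).
Definition mark n i := nth 0%N (marks n) i.

Lemma cprodS n : cprod c n.+1 = (cprod c n * c n.+1)%N.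
Proof. by rewrite /cprod big_nat_recr. Qed.

Lemma cprod_gt0 n : (0 < cprod c n)%N.
Proof.
elim: n => [|n IH]; first by rewrite /cprod big_geq.
by rewrite cprodS muln_gt0 IH /=; have := @c_ge2 n.+1 isT; lia.
Qed.

Lemma width_gt0 n : 0 < width n.
Proof. by rewrite invr_gt0 ltr0n cprod_gt0. Qed.

Lemma widthS n : (1 <= n)%N -> width n = (c n)%:R * width n.+1.
Proof.
case: n => // n _; rewrite /Defs.width /= cprodS natrM invfM mulrCA mulfV ?mulr1 //.
by rewrite pnatr_eq0; have := @c_ge2 n.+1 isT; lia.
Qed.

Lemma width1 : width 1 = 1.
Proof. by rewrite /Defs.width /cprod big_geq // invr1. Qed.

Lemma width_le n : width n.+1 <= 2^-1 ^+ n.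
Proof.
elim: n => [|n IH]; first by rewrite width1.
have := @widthS n.+1 isT; have cn := @c_ge2 n.+1 isT => ww.
have : 2 * width n.+2 <= 2^-1 ^+ n.
  apply: le_trans IH; rewrite ww ler_wpM2r ?(ltW (width_gt0 _)) //.
  by rewrite ler_nat.
by rewrite exprS; lra.
Qed.

Lemma towerS n : (1 <= n)%N -> tower c sp n.+1 =
  flatten [seq [seq a + k.-1%:R * width n.+1 | a <- tower c sp n] ++ sp n k
    | k <- iota 1 (c n)].
Proof. by case: n. Qed.

Lemma marked_towerS n : (1 <= n)%N -> marked_tower n.+1 =
  flatten [seq [seq (p.1 + k.-1%:R * width n.+1, p.2) | p <- marked_tower n]
     ++ [seq (a, 0%N) | a <- sp n k] | k <- iota 1 (c n)].
Proof. by case: n. Qed.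

Lemma marked_tower_base n : unzip1 (marked_tower n) = tower c sp n.
Proof.
elim: n => // -[//|n] IH; rewrite towerS // marked_towerS // /unzip1 map_flatten.
rewrite -IH -map_comp; congr flatten; apply: eq_map => k.
rewrite [LHS]map_cat -!map_comp; congr (_ ++ _).
by rewrite -[RHS]map_id; apply: eq_map.
Qed.

Lemma marksS n : (1 <= n)%N -> marks n.+1 =
  flatten [seq marks n ++ nseq (size (sp n k)) 0%N | k <- iota 1 (c n)].
Proof.
move=> n1; rewrite /marks marked_towerS // /unzip2 map_flatten; congr flatten.
rewrite -map_comp; apply: eq_map => k /=.
rewrite map_cat -!map_comp /=; congr (_ ++ _).
by elim: (sp n k) => //= a l ->.
Qed.

Lemma size_marks n : size (marks n) = height n.
Proof. by rewrite /height -marked_tower_base !size_map. Qed.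

Lemma sumn_marks n : (1 <= n)%N -> sumn (marks n) = cprod c n.-1.
Proof.
elim: n => // -[_ _|n IH _]; first by rewrite /cprod big_geq.
rewrite marksS //= cprodS -IH // sumn_flatten -map_comp.
rewrite (@eq_map _ _ _ (fun=> sumn (marks n.+1))); last first.
  by move=> k /=; rewrite sumn_cat sumn_nseq addn0.
by rewrite sumnE big_map big_const_seq count_predT size_iota iter_addn_0.
Qed.

(** A passage through a later tower consists of passages through the n-th tower,
separated by spacers. *)
Lemma marks_built n m : (1 <= n)%N -> (n <= m)%N ->
  built_from (marks n) (marks m).
Proof.
move=> n1; elim: m => [|m IH]; first by lia.
rewrite leq_eqVlt => /predU1P[->|nm]; first exact: built_from_self.
rewrite marksS; last by lia.
apply: built_from_flatten => l /mapP[k _ ->].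
by apply: built_from_cat; [exact: IH|exact: built_from_nseq0].
Qed.

Lemma sum_mark_window n m a b : (1 <= n)%N -> (n <= m)%N ->
  (b - a <= height n)%N ->
  (\sum_(a <= i < b) mark m i <= 2 * cprod c n.-1)%N.
Proof.
move=> n1 nm ab; rewrite -sumn_marks //; apply: built_from_sum.
  exact: marks_built.
by rewrite size_marks.
Qed.

Lemma sum_mark n : (1 <= n)%N ->
  (\sum_(0 <= i < height n) mark n i)%N = cprod c n.-1.
Proof.
by move=> n1; rewrite -size_marks -sumn_marks // sumnE [RHS](big_nth 0%N).
Qed.

Lemma height1 : height 1 = 1%N. Proof. by []. Qed.

Lemma height_double n : (1 <= n)%N -> (2 * height n <= height n.+1)%N.
Proof.
move=> n1; rewrite -!size_marks marksS // size_flatten /shape -map_comp.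
have := c_ge2 n1; case: (c n) => [|[|m]] // _ /=.
rewrite !size_cat /=; lia.
Qed.

Lemma height_gt n : (n < height n.+1)%N.
Proof.
elim: n => [|n IH]; first by rewrite height1.
by have := @height_double n.+1 isT; lia.
Qed.

Lemma height_leq m n : (1 <= m)%N -> (m <= n)%N -> (height m <= height n)%N.
Proof.
move=> m1; elim: n => [|n IH]; first by lia.
rewrite leq_eqVlt => /predU1P[->//|mn].
by apply: leq_trans (IH mn) _; have := @height_double n; lia.
Qed.

Lemma mem_marked n i : (i < height n)%N ->
  (base n i, mark n i) \in marked_tower n.
Proof.
move=> ih; have sz : size (marked_tower n) = height n.
  by rewrite /height -marked_tower_base size_map.
have -> : (base n i, mark n i) = nth (0, 0%N) (marked_tower n) i.
  rewrite /Defs.base /mark /marks -marked_tower_base.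
  by rewrite !(nth_map (0, 0%N)) ?sz //; case: nth.
by rewrite mem_nth // sz.
Qed.

Lemma marked_tower_itv n p : (1 <= n)%N -> p \in marked_tower n ->
  p.2 = 0%N \/ p.2 = 1%N /\ 0 <= p.1 /\ p.1 + width n <= 1.
Proof.
elim: n p => // -[|n] IH p _.
  by rewrite inE => /eqP -> /=; right; rewrite width1; do !split => //; lra.
rewrite marked_towerS // => /flatten_mapP[k].
rewrite mem_iota => /andP[k1 kc].
rewrite mem_cat => /orP[|/mapP[a _ ->]]; last by left.
move=> /mapP[q qn ->] /=; have [->|[-> [q0 q1]]] := IH q isT qn; first by left.
right; split=> //; have wp := width_gt0 n.+2; split.
  by rewrite addr_ge0 // mulr_ge0 // ltW.
apply: le_trans q1; rewrite -addrA lerD2l (widthS (isT : 1 <= n.+1)%N).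
rewrite -[X in _ + X]mul1r -mulrDl ler_wpM2r ?(ltW wp) //.
by rewrite natr1 ler_nat; lia.
Qed.

Lemma mark_itv n i : (1 <= n)%N -> (i < height n)%N ->
  mark n i = 0%N \/ mark n i = 1%N /\ 0 <= base n i /\ base n i + width n <= 1.
Proof. by move=> n1 ih; exact: marked_tower_itv (mem_marked ih). Qed.

Lemma tower_column n i k : (1 <= n)%N -> (i < height n)%N -> (k < c n)%N ->
  exists2 j, (j < height n.+1)%N & base n.+1 j = base n i + k%:R * width n.+1.
Proof.
move=> n1 ih kc.
have : base n i + k%:R * width n.+1 \in tower c sp n.+1.
  rewrite towerS //; apply/flatten_mapP; exists k.+1; first by rewrite mem_iota; lia.
  by rewrite mem_cat; apply/orP; left; apply: map_f; rewrite mem_nth.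
move=> /(nthP 0)[j jh bj]; exists j => //; exact: bj.
Qed.

(** * Levels up to null sets *)

Lemma measurable_level n i : measurable (level n i).
Proof. exact: measurable_itv. Qed.

Lemma lebesgue_measure_level n i : mu (level n i) = (width n)%:E.
Proof.
rewrite lebesgue_measure_itv /= lte_fin ltrDl width_gt0.
by rewrite -EFinD addrAC subrr add0r.
Qed.

Lemma level_shift n i j x : level n i x -> level n j (x + (base n j - base n i)).
Proof. by rewrite /Defs.level /= !in_itv /=; lra. Qed.

Lemma level_inj n i j x : (i < height n)%N -> (j < height n)%N ->
  level n i x -> level n j x -> i = j.
Proof.
move=> ih jh xi xj; apply/eqP/negPn/negP => /eqP ij.
by have : set0 x by rewrite -(level_disjoint spP ih jh ij).
Qed.

(** The levels of the n-th tower are cut into levels of the next one; only the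
cutting points, which are countable, get lost because levels are open. *)
Lemma tower_nested n : (1 <= n)%N -> {ae mu, forall x,
  (exists2 i, (i < height n)%N & level n i x) ->
  exists2 i, (i < height n.+1)%N & level n.+1 i x}.
Proof.
move=> n1.
pose cuts := \bigcup_i \bigcup_k [set base n i + k%:R * width n.+1].
have : mu.-negligible cuts.
  apply: negligible_bigcup => i; apply: negligible_bigcup => k.
  by apply/negligibleP => //; exact: lebesgue_measure_set1.
apply: negligibleS => x /= /not_implyP[[i ih xi] nx]; apply: contrapT => ncut.
apply: nx; have w0 := width_gt0 n.+1.
move: (xi); rewrite /Defs.level /= in_itv /= => /andP[bx xb].
set t := (x - base n i) / width n.+1.
have xE : x = base n i + t * width n.+1 by rewrite /t divfK ?gt_eqF // addrC subrK.
have t0 : 0 <= t by rewrite divr_ge0 ?(ltW w0) // subr_ge0 ltW.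
have /andP[kt tk] := truncn_itv t0.
set k := Num.truncn t in kt tk.
have kc : (k < c n)%N.
  rewrite -(ltr_nat R); apply: le_lt_trans kt _.
  by rewrite ltr_pdivrMr // -widthS // ltrBlDl.
have [j jh bj] := tower_column n1 ih kc.
exists j => //; rewrite /Defs.level /= in_itv /= bj.
have ktn : k%:R != t.
  by apply/eqP => kt'; apply: ncut; exists i => //; exists k => //=; rewrite kt'.
have {}kt : k%:R < t by rewrite lt_neqAle ktn kt.
apply/andP; split; first by rewrite [ltRHS]xE ltrD2l ltr_pM2r.
rewrite {1}xE -addrA ltrD2l -{3}(mul1r (width n.+1)) -mulrDl ltr_pM2r //.
by rewrite natr1.
Qed.

(** At most 2 K levels lie within K steps of the top or the bottom of the n-th
tower, and their total measure 2 K / C_(n-1) is summable over n because C_n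
grows at least geometrically: the Borel-Cantelli lemma applies. *)
Lemma tower_interior K : {ae mu, forall x, exists m, forall n i, (m <= n)%N ->
  (i < height n)%N -> level n i x -> (K <= i)%N /\ (i + K < height n)%N}.
Proof.
pose G n i := level n i `|` level n (height n - i.+1).
have mG n i : measurable (G n i) by apply: measurableU; exact: measurable_level.
pose F n := \big[setU/set0]_(i < K) G n i.
have mF n : measurable (F n) by apply: bigsetU_measurable.
have muF n : (mu (F n) <= ((8 * K%:R) / (2 ^ n.+1)%:R)%:E)%E.
  apply: (@le_trans _ _ (\sum_(i < K) (2 * width n)%:E)%E).
    apply: le_trans (Boole_inequality mu (A := G n) (fun i _ => mG n i)) _.
    apply: lee_sum => i _.
    have : (mu (G n i) <= mu (level n i) + mu (level n (height n - i.+1)%N))%E.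
      exact: (measureU2 mu (measurable_level n i) (measurable_level n _)).
    move=> /le_trans; apply; rewrite !lebesgue_measure_level // -EFinD lee_fin; lra.
  rewrite sumEFin lee_fin sumr_const card_ord -[leLHS]mulr_natl.
  rewrite [leRHS](_ : _ = K%:R * (2 * (2 * (2^-1 ^+ n)))).
    rewrite ler_wpM2l //. rewrite ler_wpM2l //; case: n => [|n].
      by rewrite /Defs.width /cprod big_geq // expr0 invr1; lra.
    by rewrite (le_trans (width_le n)) // exprS; lra.
  rewrite expnS natrM natrX exprVn; field.
  by rewrite expf_neq0.
have F0 : mu (lim_sup_set F) = 0.
  apply: lim_sup_set_cvg0 => //.
  apply: (@le_lt_trans _ _ (8 * K%:R)%:E); last exact: ltry.
  apply: le_trans (@epsilon_trick0 R (8 * K%:R) xpredT _); last by rewrite mulr_ge0.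
  by apply: lee_nneseries => [n _ _|n _]; [exact: measure_ge0|exact: muF].
exists (lim_sup_set F); split => //.
  by apply: bigcap_measurable => // n _; apply: bigcup_measurable => k _; exact: mF.
move=> x /= nx m _ /=; apply: contrapT => nF; apply: nx; exists m => n i mn ih xi.
have nFx : ~ F n x by move=> Fx; apply: nF; exists n.
split; rewrite leqNgt; apply/negP => lt; apply: nFx.
  by rewrite /F -(bigcup_mkord K (G n)); exists i => //=; left.
rewrite /F -(bigcup_mkord K (G n)); exists (height n - i.+1)%N => /=; first by lia.
by right; rewrite (_ : (_ - _ = i)%N) //; lia.
Qed.

Variables T T' : R -> R.
Hypothesis TP : rank_one c s T T' sp.

Lemma orbit_forward n i d : (i + d < height n)%N -> {ae mu, forall x,
  level n i x -> iter d T x = x + (base n (i + d) - base n i)}.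
Proof.
elim: d => [_|d IH id]; first by apply: aeW => x _; rewrite addn0 subrr addr0.
have id' : (i + d < height n)%N by lia.
have id1 : ((i + d).+1 < height n)%N by rewrite -addnS.
have := ae_shift (base n (i + d) - base n i) (translates TP id1).
move: (IH id'); apply: filterS2 => x Hd Hx xi.
rewrite iterS Hd // Hx; last exact: level_shift.
by rewrite addnS; ring.
Qed.

(** T' acts as the opposite translation, since it inverts T on the level
below. *)
Lemma orbit_backward n i d : (i + d < height n)%N -> {ae mu, forall x,
  level n (i + d) x -> iter d T' x = x + (base n i - base n (i + d))}.
Proof.
elim: d i => [|d IH] i id; first by apply: aeW => x _; rewrite addn0 subrr addr0.
have back : {ae mu, forall x, level n i.+1 x ->
    T' x = x + (base n i - base n i.+1)}.
  have i1 : (i.+1 < height n)%N by lia.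
  have := ae_shift (base n i - base n i.+1) (translates TP i1).
  have := ae_shift (base n i - base n i.+1) (T_invertible TP).
  apply: filterS2 => x Hinv Htr xi.
  have yi := level_shift i xi.
  have [|TT _] := Hinv; first exact: (level_in_space spP (ltnW i1) yi).
  rewrite -[RHS]TT Htr //; congr T'; ring.
have id' : (i.+1 + d < height n)%N by lia.
have := ae_shift (base n i.+1 - base n (i.+1 + d)) back.
move: (IH _ id'); apply: filterS2 => x Hd Hx; rewrite addnS -addSn => xi.
rewrite iterS Hd // Hx; last exact: level_shift.
by ring.
Qed.

Lemma orbit_tower n i j : (i < height n)%N -> (j < height n)%N ->
  {ae mu, forall x, level n i x -> iterz T T' (j%:Z - i%:Z) x = x + (base n j - base n i)}.
Proof.
move=> ih jh; have [ij|/ltnW ji] := leqP i j.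
  rewrite subzn // -[in base n j](subnKC ij).
  by apply: orbit_forward; rewrite subnKC.
have iE := subnKC ji.
have E : j%:Z - i%:Z = - ((i - j)%N)%:Z by rewrite -subzn ?opprB.
rewrite E; move: iE; case: (i - j)%N => [|d] iE.
  by rewrite -iE addn0; apply: aeW => x _; rewrite /= subrr addr0.
by rewrite -NegzE -iE; apply: orbit_backward; rewrite iE.
Qed.

(** The marked levels of the n-th tower are disjoint subsets of (0, 1) of total
measure C_(n-1) / C_(n-1) = 1, so they fill (0, 1) up to a null set, and the
unmarked levels avoid (0, 1) up to a null set. *)
Lemma mark_unit n i : (1 <= n)%N -> (i < height n)%N -> {ae mu, forall x,
  level n i x -> \1_unit_itv x = (mark n i)%:R :> R}.
Proof.
move=> n1 ih; pose P (k : 'I_(height n)) := mark n k == 1%N.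
pose U := \big[setU/set0]_(k < height n | P k) level n k.
have mU : measurable U by apply: bigsetU_measurable => k _; exact: measurable_level.
have UJ : U `<=` unit_itv.
  rewrite /U -bigcup_seq_cond => x /= [k /= /andP[_ /eqP mk]].
  have [|[_ [b0 b1]]] := mark_itv n1 (ltn_ord k); first by rewrite mk.
  by rewrite /Defs.level /= !in_itv /=; lra.
have mu1 : mu unit_itv = 1%E.
  by rewrite lebesgue_measure_itv /= lte_fin ltr01 oppr0 adde0.
have muU : mu U = 1%E.
  rewrite /U measure_bigsetU_ord_cond.
  - rewrite (eq_bigr (fun k : 'I__ => (width n)%:E)); last first.
      by move=> k _; exact: lebesgue_measure_level.
    rewrite sumEFin; congr EFin.
    rewrite -[RHS](@mulVf _ (cprod c n.-1)%:R) ?pnatr_eq0 -?lt0n ?cprod_gt0 //.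
    rewrite -/(width n) -(sum_mark n1) big_mkord natr_sum mulr_sumr big_mkcond /=.
    apply: eq_bigr => k _; rewrite /P.
    by have [->|[-> _]] := mark_itv n1 (ltn_ord k); rewrite /= ?mulr0 ?mulr1.
  - by move=> k _; exact: measurable_level.
  - apply/trivIsetP => j k _ _ /eqP jk; apply: (level_disjoint spP) => //.
    by move=> /val_inj.
exists (unit_itv `\` U); split.
- by apply: measurableD => //; exact: measurable_itv.
- rewrite measureD //=; first by rewrite setIidr // mu1 muU subee.
  by rewrite mu1 ltry.
- move=> x /= /not_implyP[xi xE]; apply: contrapT => xU; apply: xE.
  rewrite indicE; have [m0|[m1 [b0 b1]]] := mark_itv n1 ih; last first.
    rewrite m1 mem_set //=; move: xi; rewrite /Defs.level /= !in_itv /=; lra.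
  rewrite m0 memNset // => xJ; apply: xU; split=> //.
  rewrite /U -bigcup_seq_cond => -[k /= /andP[_ /eqP mk]] xk.
  by move: mk; rewrite -(level_inj ih (ltn_ord k) xi xk) m0.
Qed.

(** * Orbits of regular points *)

(** The points whose orbits can be read off from the towers: every finite piece
of the orbit lies inside a single passage through each sufficiently tall tower,
and during a passage the powers of T are the translations between levels, with
visits to (0, 1) recorded by the marks. Almost all points are of
this kind, so that the dynamics can be studied on them alone. *)
Record regular_point (x : R) : Prop := RegularPoint {
  regular_deep : forall K, exists m, forall n, (m <= n)%N ->
    exists i, [/\ (K <= i)%N, (i + K < height n)%N & level n i x];
  regular_orbit : forall n i j, (i < height n)%N -> (j < height n)%N ->
    level n i x -> iterz T T' (j%:Z - i%:Z) x = x + (base n j - base n i);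
  regular_mark : forall n i j, (1 <= n)%N ->
    (i < height n)%N -> (j < height n)%N -> level n i x ->
    \1_unit_itv (x + (base n j - base n i)) = (mark n j)%:R :> R
}.

Lemma ae_regular : {ae mu, forall x, rank_one_space c s x -> regular_point x}.
Proof.
have nested : {ae mu, forall x n, (1 <= n)%N ->
    (exists2 i, (i < height n)%N & level n i x) ->
    exists2 i, (i < height n.+1)%N & level n.+1 i x}.
  apply: ae_foralln => n; have [n1|] := leqP 1 n; last first.
    by move=> ?; apply: aeW => x ?.
  by apply: filterS (tower_nested n1) => x Hx _.
have deep : {ae mu, forall x K, exists m, forall n i, (m <= n)%N ->
    (i < height n)%N -> level n i x -> (K <= i)%N /\ (i + K < height n)%N}.
  by apply: ae_foralln => K; exact: tower_interior.
have orbit : {ae mu, forall x n i j, (i < height n)%N -> (j < height n)%N ->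
    level n i x -> iterz T T' (j%:Z - i%:Z) x = x + (base n j - base n i)}.
  apply: ae_foralln => n; apply: ae_foralln => i; apply: ae_foralln => j.
  have [ih|?] := boolP (i < height n)%N; last by apply: aeW.
  have [jh|?] := boolP (j < height n)%N; last by apply: aeW.
  by apply: filterS (orbit_tower ih jh) => x Hx _ _.
have marked : {ae mu, forall x n i j, (1 <= n)%N -> (i < height n)%N ->
    (j < height n)%N -> level n i x ->
    \1_unit_itv (x + (base n j - base n i)) = (mark n j)%:R :> R}.
  apply: ae_foralln => n; apply: ae_foralln => i; apply: ae_foralln => j.
  have [n1|?] := boolP (1 <= n)%N; last by apply: aeW.
  have [jh|?] := boolP (j < height n)%N; last by apply: aeW.
  have := ae_shift (base n j - base n i) (mark_unit n1 jh).
  apply: filterS => x Hx _ _ _ xi; apply: Hx; exact: level_shift.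
apply: filter_app (level_exhaust spP); apply: filter_app nested.
apply: filter_app deep; move: orbit marked.
apply: filterS2 => x xorb xmark xdeep xnest xexh xX.
split => // K; have [n0 [i0 [i0h xi0]]] := xexh xX.
have n01 : (1 <= n0)%N by case: n0 i0h {xi0}.
have xn n : (n0 <= n)%N -> exists2 i, (i < height n)%N & level n i x.
  elim: n => [|n IH]; first by lia.
  rewrite leq_eqVlt => /predU1P[<-|nn]; first by exists i0.
  by apply: xnest; [lia|exact: IH].
have [m mP] := xdeep K.
exists (maxn m n0) => n; rewrite geq_max => /andP[mn n0n].
have [i ih xi] := xn n n0n; exists i.
by have [] := mP n i mn ih xi.
Qed.

Lemma symmetric_sum_tower (f : R -> R) x n i N : regular_point x ->
  level n i x -> (0 < N)%N -> (N <= i.+1)%N -> (i + N <= height n)%N ->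
  symmetric_sum T T' N f x =
    \sum_(i.+1 - N <= l < i + N) f (x + (base n l - base n i)).
Proof.
move=> xreg xi N0 Ni iN; rewrite /symmetric_sum.
rewrite -(add0n (i.+1 - N)%N) big_addn.
have -> : (i + N - (i.+1 - N) = N.*2.-1)%N by lia.
rewrite big_mkord; apply: eq_bigr => l _; congr f.
have lN : (l < N.*2.-1)%N := ltn_ord l.
rewrite -(regular_orbit xreg) //; [congr (iterz T T' _ x); lia|lia|lia].
Qed.

Lemma ler_sum_window (F : nat -> R) a b a' b' : (forall i, 0 <= F i) ->
  (a' <= a)%N -> (b <= b')%N ->
  \sum_(a <= i < b) F i <= \sum_(a' <= i < b') F i.
Proof.
move=> F0 aa bb; have [ab|/ltnW ba] := leqP a b; last first.
  by rewrite (big_geq ba) sumr_ge0.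
rewrite (@big_cat_nat _ _ _ a a' b') ?(leq_trans ab) //=.
rewrite (@big_cat_nat _ _ _ b a b') //= addrCA lerDl.
by rewrite addr_ge0 // sumr_ge0.
Qed.

Lemma common_tower x y (k : int) K : regular_point x -> y = iterz T T' k x ->
  exists n i j, [/\ (K <= i)%N /\ (i + K < height n)%N,
    (K <= j)%N /\ (j + K < height n)%N,
    (j <= i + `|k|)%N /\ (i <= j + `|k|)%N,
    level n i x & y = x + (base n j - base n i)].
Proof.
move=> xreg ->; have [m mP] := regular_deep xreg (K + `|k|)%N.
have [i [Ki iK xi]] := mP _ (leqnn m).
exists m, i, (absz (i%:Z + k)%R).
have jE : (absz (i%:Z + k)%R)%:Z = i%:Z + k by lia.
split; [lia|lia|lia|by []|].
rewrite -(regular_orbit xreg) //; [|lia|lia].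
by rewrite jE addrAC subrr add0r.
Qed.

Lemma symmetric_sum_window (f : R -> R) x y n i j d N : (forall z, 0 <= f z) ->
  regular_point x -> regular_point y -> level n i x ->
  y = x + (base n j - base n i) -> (0 < N)%N ->
  (N + d <= i)%N -> (i + (N + d) < height n)%N ->
  (N <= j)%N -> (j + N < height n)%N ->
  (j <= i + d)%N -> (i <= j + d)%N ->
  symmetric_sum T T' N f y <= symmetric_sum T T' (N + d) f x.
Proof.
move=> f0 xreg yreg xi yE N0 iN1 iN2 jN1 jN2 ji ij.
have yj : level n j y by rewrite yE; exact: level_shift.
rewrite (symmetric_sum_tower f xreg xi); [|lia|lia|lia].
rewrite (symmetric_sum_tower f yreg yj); [|lia|lia|lia].
rewrite [leLHS](eq_bigr (fun l => f (x + (base n l - base n i)))); last first.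
  by move=> l _; congr f; rewrite yE; ring.
by apply: ler_sum_window => //; lia.
Qed.

(** Moving the base point k steps along its orbit shifts the window of times by
k, and the shifted window lies inside the original one enlarged by |k|. *)
Lemma symmetric_sum_orbit (f : R -> R) x y (k : int) N : (forall z, 0 <= f z) ->
  regular_point x -> regular_point y -> y = iterz T T' k x -> (0 < N)%N ->
  symmetric_sum T T' N f y <= symmetric_sum T T' (N + `|k|) f x /\
  symmetric_sum T T' N f x <= symmetric_sum T T' (N + `|k|) f y.
Proof.
move=> f0 xreg yreg yE N0.
have [n [i [j [[i1 i2] [j1 j2] [ji ij] xi yE']]]] :=
  common_tower (N + `|k|)%N xreg yE.
have yj : level n j y by rewrite yE'; exact: level_shift.
split; [apply: (symmetric_sum_window f0 xreg yreg xi yE')|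
  apply: (symmetric_sum_window f0 yreg xreg yj (i := j) (j := i))] => //; try lia.
by rewrite yE'; ring.
Qed.

(** * Visits to the unit interval *)

(** If N is at least the height, the times |k| < N contain the whole passage of
x through the n-th tower, and such a passage makes C_(n-1) visits to (0, 1). *)
Lemma symmetric_sum_unit_ge x n i N : regular_point x -> (1 <= n)%N ->
  (i < height n)%N -> level n i x -> (height n <= N)%N ->
  (cprod c n.-1)%:R <= symmetric_sum T T' N (\1_unit_itv : R -> R) x.
Proof.
move=> xreg n1 ih xi hN; rewrite -(sum_mark n1) natr_sum /symmetric_sum.
pose F l := (\1_unit_itv : R -> R) (iterz T T' (l%:Z - N.-1%:Z) x).
rewrite -(big_mkord xpredT F).
rewrite [leLHS](@eq_big_nat _ _ _ _ _ _ (fun j => F (j + (N.-1 - i))%N)); last first.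
  move=> j /andP[_ jh]; rewrite -(regular_mark xreg n1 ih jh xi).
  rewrite -(regular_orbit xreg ih jh xi) /F; congr (\1__ (iterz T T' _ x)); lia.
rewrite -[X in \sum_(_ <= _ < X) _](addnK (N.-1 - i)%N).
rewrite -(big_addn 0 _ _ xpredT F) add0n.
by apply: ler_sum_window => //; lia.
Qed.

(** The window |k| < N is the union of two windows no longer than the n-th
tower, each meeting at most two passages through it. *)
Lemma symmetric_sum_unit_le x n N : regular_point x -> (1 <= n)%N ->
  (0 < N)%N -> (N <= height n)%N ->
  symmetric_sum T T' N (\1_unit_itv : R -> R) x
    <= (4 * cprod c n.-1)%:R.
Proof.
move=> xreg n1 N0 Nh; have [m mP] := regular_deep xreg N.
have [i [Ni iN xi]] := mP _ (leq_maxl m n).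
have nm := leq_maxr m n.
rewrite (symmetric_sum_tower _ xreg xi); [|lia|lia|lia].
rewrite (@eq_big_nat _ _ _ _ _ _ (fun l => (mark (maxn m n) l)%:R : R)); last first.
  move=> l /andP[l1 l2]; rewrite (regular_mark xreg) //; [lia|lia|lia].
rewrite -natr_sum ler_nat (@big_cat_nat _ _ _ i) /=; [|lia|lia].
have -> : (4 * cprod c n.-1 = 2 * cprod c n.-1 + 2 * cprod c n.-1)%N by lia.
by apply: leq_add; apply: sum_mark_window => //; lia.
Qed.

(** * The maximal inequality along orbits *)

(** All windows of times around 0 are allowed, not only the symmetric ones,
because this is what [window_maximal] controls. Keeping the windows inside the
n-th tower turns each of them into a condition on finitely many translates. *)
Definition excess (A B : set R) (lam : R) (n i : nat) : set R :=
  [set x | [/\ level n i x, B x &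
   exists b e, [/\ (b <= i)%N, (i < e <= height n)%N &
     2 * (lam * \sum_(b <= l < e) \1_B (x + (base n l - base n i)))
       < \sum_(b <= l < e) \1_A (x + (base n l - base n i))]]].

Lemma measurable_excess A B lam n i :
  measurable A -> measurable B -> measurable (excess A B lam n i).
Proof.
move=> mA mB.
have mS V b e : measurable V -> measurable_fun setT
    (fun x : R => \sum_(b <= l < e) \1_V (x + (base n l - base n i)) : R).
  move=> mV; apply: measurable_sum => l.
  exact: measurable_indic (measurable_preimage_shift _ mV).
pose W b e : set R := [set x |
  2 * (lam * \sum_(b <= l < e) \1_B (x + (base n l - base n i)))
       < \sum_(b <= l < e) \1_A (x + (base n l - base n i))].
have mW b e : measurable (W b e).
  have mlt : measurable_fun setT (fun x : R =>
      2 * (lam * \sum_(b <= l < e) \1_B (x + (base n l - base n i)))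
       < \sum_(b <= l < e) \1_A (x + (base n l - base n i)) : bool).
    apply: measurable_fun_ltr; last exact: mS.
    by do 2![apply: measurable_funM => //]; exact: mS.
  rewrite -[X in measurable X]setTI.
  exact: (mlt measurableT [set true]).
rewrite (_ : excess _ _ _ _ _ = level n i `&` (B `&`
  \bigcup_(b in [set b | (b <= i)%N])
    \bigcup_(e in [set e | (i < e <= height n)%N]) W b e)).
  apply: measurableI; first exact: measurable_level.
  apply: measurableI => //; apply: bigcup_measurable => b _.
  by apply: bigcup_measurable => e _.
apply/seteqP; split => x.
  move=> [xi xB [b [e [bi ie lt]]]]; split => //; split => //.
  by exists b => //; exists e.
by move=> [xi [xB [b bi [e ie lt]]]]; split => //; exists b, e.
Qed.

(** Over a point t of the bottom level the tower is a finite sequence of points.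
Apply [window_maximal] to the indicators of A and B along this sequence and
integrate over t. *)
Lemma measure_excess_le A B lam n : measurable A -> measurable B -> 0 <= lam ->
  (lam%:E * mu (\big[setU/set0]_(i < height n) excess A B lam n i)
    <= 2%:E * mu A)%E.
Proof.
move=> mA mB lam0; pose d i := base n i - base n 0.
have mX i : measurable (excess A B lam n i) by exact: measurable_excess.
have mAl i : measurable (level n i `&` A).
  by apply: measurableI => //; exact: measurable_level.
pose P i := [set t | excess A B lam n i (t + d i)].
pose Q i := [set t | (level n i `&` A) (t + d i)].
(* All the sets are translated to the bottom level. *)
apply: (@le_trans _ _ (lam%:E * \sum_(0 <= i < height n) mu (P i))%E).
  apply: lee_wpmul2l; first by rewrite lee_fin.
  rewrite (eq_bigr (fun i => mu (excess A B lam n i))); last first.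
    by move=> i _; exact: lebesgue_measure_shift.
  rewrite big_mkord.
  exact: (Boole_inequality mu (A := excess A B lam n) (fun i _ => mX i)).
apply: (@le_trans _ _ (2%:E * \sum_(0 <= i < height n) mu (Q i))%E); last first.
  apply: lee_wpmul2l => //.
  rewrite (eq_bigr (fun i => mu (level n i `&` A))); last first.
    by move=> i _; exact: lebesgue_measure_shift.
  rewrite big_mkord -(measure_bigsetU_ord mu) //; first last.
  - apply/trivIsetP => i j _ _ /eqP ij; rewrite setIACA.
    rewrite (level_disjoint spP) ?set0I //.
    by move=> /val_inj.
  - by move=> i; exact: mAl.
  - apply: le_measure; rewrite ?inE //.
      by apply: bigsetU_measurable => i _; exact: mAl.
    by rewrite -(bigcup_mkord _ (fun i => level n i `&` A)) => x [i _ []].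
apply: sum_indic_measure_le => //.
- by move=> i; exact: measurable_preimage_shift.
- by move=> i; exact: measurable_preimage_shift.
move=> t; have [t0|nt0] := pselect (level n 0 t); last first.
  rewrite [X in lam * X]big1 ?mulr0 ?mulr_ge0 ?sumr_ge0 //.
  move=> i _; rewrite indicE memNset // => -[ti _ _]; apply: nt0.
  by have := level_shift 0 ti; rewrite /d (_ : _ + _ = t) //; ring.
have tl i : level n i (t + d i) by exact: level_shift.
have dl i l : t + d i + (base n l - base n i) = t + d l by rewrite /d; ring.
pose f l : R := \1_A (t + d l); pose g l : R := lam * \1_B (t + d l).
pose E i := `[< excess A B lam n i (t + d i) >].
apply: (@le_trans _ _ (\sum_(0 <= i < height n | E i) g i)).
  rewrite mulr_sumr [leRHS]big_mkcond; apply: ler_sum => i _.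
  rewrite /g /E !indicE; case: asboolP => [Pi|nPi]; last by rewrite memNset // mulr0.
  by rewrite mem_set //; case: Pi => _ Bi _; rewrite mem_set.
apply: le_trans (window_maximal (f := f) _ _ _) _.
- by move=> i; rewrite /f.
- by move=> i; rewrite /g mulr_ge0.
- move=> i ih /asboolP[_ _ [b [e [bi ie lt]]]]; exists b, e; split => //.
  apply/ltW; rewrite /f /g -mulr_sumr.
  under [X in _ * (_ * X)]eq_bigr do rewrite -(dl i).
  by under [ltRHS]eq_bigr do rewrite -(dl i).
- rewrite ler_wpM2l //; apply: ler_sum => i _.
  rewrite /f !indicE; case: (boolP (_ \in A)) => // /set_mem Ai.
  by rewrite mem_set //; split.
Qed.

(** If no constant lam works at x, then for each lam the point x belongs to the
excess sets of all sufficiently tall towers. The lower limit of these sets has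
measure at most 2 mu(A) / lam, and lam is arbitrary. *)
Lemma ae_symmetric_sum_dominated A B : measurable A -> measurable B ->
  (mu A < +oo)%E -> {ae mu, forall x, regular_point x -> B x ->
    exists2 lam : R, 0 < lam & forall N, (0 < N)%N ->
      symmetric_sum T T' N (\1_A : R -> R) x
        <= lam * symmetric_sum T T' N (\1_B : R -> R) x}.
Proof.
move=> mA mB Aoo.
pose F (k n : nat) := \big[setU/set0]_(i < height n) excess A B k.+1%:R n i.
have mF k n : measurable (F k n).
  by apply: bigsetU_measurable => i _; exact: measurable_excess.
pose L k := \bigcup_m \bigcap_(n >= m) F k n.
have mL k : measurable (L k).
  apply: bigcup_measurable => m _.
  by apply: bigcap_measurable => [|n _]; [exists m => /=|exact: mF].
have muA : mu A = (fine (mu A))%:E by rewrite fineK // ge0_fin_numE.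
have muL k : (mu (L k) <= (2 * fine (mu A) / k.+1%:R)%:E)%E.
  apply: measure_liminf_le => n; first exact: mF.
  have := @measure_excess_le A B k.+1%:R n mA mB (ler0n _ _).
  rewrite muA -EFinM -/(F k n) muleC -lee_pdivlMr ?ltr0n //.
exists (\bigcap_k L k); split.
- exact: bigcapT_measurable.
- apply/eqP; rewrite -measure_le0; apply/lee_addgt0Pr => e e0; rewrite add0e.
  set M := 2 * fine (mu A) in muL.
  have [k Mk] : exists k : nat, M / k.+1%:R <= e.
    exists (Num.truncn (M / e)); rewrite ler_pdivrMr ?ltr0n //.
    rewrite mulrC -ler_pdivrMr //; apply: ltW.
    by rewrite truncnS_gt // num_real.
  apply: (@le_trans _ _ (mu (L k))).
    apply: le_measure; rewrite ?inE; [exact: bigcapT_measurable|exact: mL|].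
    by move=> x /(_ k I).
  by apply: le_trans (muL k) _; rewrite lee_fin.
(* The constant is 2 (k + 1): excess sets are defined with a factor 2 lam. *)
move=> x /= /not_implyP[xreg /not_implyP[xB nlam]] k _.
apply: contrapT => nL; apply: nlam; exists (2 * k.+1%:R); first by rewrite mulr_gt0.
move=> N N0; rewrite leNgt; apply/negP => lt; apply: nL.
have [m mP] := regular_deep xreg N; exists m => // n /= mn.
have [i [Ni iN xi]] := mP _ mn.
rewrite /F -(bigcup_mkord _ (excess A B k.+1%:R n)).
exists i => /=; first by lia.
split => //; exists (i.+1 - N)%N, (i + N)%N; split; [lia|lia|].
by rewrite mulrA -!(symmetric_sum_tower _ xreg xi); [exact: lt|lia..].
Qed.

Lemma ae_exists (U : set R) (P : R -> Prop) : measurable U -> (0 < mu U)%E ->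
  {ae mu, forall x, P x} -> exists2 x, U x & P x.
Proof.
move=> mU U0 [N [mN N0 PN]]; apply: contrapT => nex.
move: U0; rewrite (@subset_measure0 _ _ _ mu U N) // ?ltxx // => x Ux.
by apply: PN => /= Px; apply: nex; exists x.
Qed.

(** * Ergodicity *)

Lemma width_small (d : R) : 0 < d ->
  exists m, forall n, (m <= n)%N -> width n < d.
Proof.
move=> d0; exists (Num.truncn d^-1).+1 => -[//|n]; rewrite ltnS => dn.
apply: le_lt_trans (width_le n) _; rewrite exprVn invf_plt ?posrE ?exprn_gt0 //.
apply: (lt_le_trans (truncnS_gt _)).
by rewrite -natrX ler_nat (leq_ltn_trans dn) // ltn_expl.
Qed.

(** Near a density point of U, a level of small width w containing this point
lies in the ball of radius w around it. As U misses less than a quarter of the ball,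
whose measure is 2 w, it misses less than half of the level. *)
Lemma level_density (U : set R) : measurable U -> (0 < mu U)%E ->
  (forall x, U x -> regular_point x) ->
  exists m, forall n, (m <= n)%N -> exists2 i, (i < height n)%N &
    ((width n / 2)%:E < mu (U `&` level n i))%E.
Proof.
move=> mU U0 Ureg.
have [x Ux] := ae_exists mU U0 (lebesgue_density mU).
rewrite indicE mem_set //= => cvgU.
have lt34 : 3 / 4 < 1 :> R by lra.
have [d /= d0 dP] := cvgU _ (nbhs_open_ereal_gt (f := fun=> 3 / 4) lt34).
have [m1 m1P] := width_small d0.
have [m2 m2P] := regular_deep (Ureg _ Ux) 0%N.
exists (maxn m1 m2) => n; rewrite geq_max => /andP[n1 n2].
have [i [_ ih xi]] := m2P n n2; exists i; first by lia.
have w0 := width_gt0 n.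
have /= := dP (width n); rewrite sub0r normrN gtr0_norm // => /(_ (m1P n n1) w0).
rewrite lebesgue_measure_ball ?(ltW w0) //.
set W := width n in w0 *.
have mB : measurable (ball x W) by exact: measurable_ball.
have mL : measurable (level n i) by exact: measurable_level.
have LB : level n i `<=` ball x W.
  move=> y; move: xi; rewrite /Defs.level /ball /= !in_itv /= -/W.
  move=> /andP[? ?] /andP[? ?].
  by rewrite ltr_norml; apply/andP; split; lra.
have muB : mu (ball x W) = (W *+ 2)%:E by rewrite lebesgue_measure_ball ?(ltW w0).
have muBL : mu (ball x W `\` level n i) = W%:E.
  rewrite measureD //; last by rewrite [ltLHS]muB ltry.
  rewrite setIidr // [X in (X - _)%E]muB [X in (_ - X)%E]lebesgue_measure_level.
  by rewrite -EFinB -/W mulr2n addrK.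
have le_sum : (mu (U `&` ball x W) <= mu (U `&` level n i) + W%:E)%E.
  rewrite -muBL.
  have mUL : measurable (U `&` level n i) by exact: measurableI.
  have mBL : measurable (ball x W `\` level n i) by exact: measurableD.
  apply: le_trans (measureU2 mu mUL mBL); apply: le_measure; rewrite ?inE.
  - exact: measurableI.
  - exact: measurableU.
  - move=> y [Uy By]; have [Ly|nLy] := pselect (level n i y); first by left.
    by right.
have UL_fin : mu (U `&` level n i) \is a fin_num.
  rewrite ge0_fin_numE //; apply: le_lt_trans (measureIr mu mU mL) _.
  by rewrite [ltLHS]lebesgue_measure_level ltry.
have UB_fin : mu (U `&` ball x W) \is a fin_num.
  rewrite ge0_fin_numE //; apply: le_lt_trans (measureIr mu mU mB) _.
  by rewrite [ltLHS]muB ltry.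
move: le_sum; rewrite -(fineK UL_fin) -(fineK UB_fin) -EFinD lee_fin.
rewrite inver mulrn_eq0 /= gt_eqF // -EFinM !lte_fin ltr_pdivlMr ?mulrn_wgt0 //.
by rewrite mulr2n; lra.
Qed.

(** Let Z be the set of points whose orbits miss A. If Z had positive measure,
some tower would have one level more than half filled by Z and another one more
than half filled by A. The power of T that carries the first level to the
second would then carry a point of Z into A. *)
Lemma ae_orbit_hits (A : set R) : measurable A -> (0 < mu A)%E ->
  (forall x, A x -> regular_point x) ->
  {ae mu, forall x, regular_point x -> exists k : int, A (iterz T T' k x)}.
Proof.
move=> mA A0 Areg.
pose V := \bigcup_n \bigcup_(i in [set i | (i < height n)%N]) level n i.
pose H := \bigcup_n \bigcup_(i in [set i | (i < height n)%N])
  \bigcup_(j in [set j | (j < height n)%N])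
  (level n i `&` [set x | A (x + (base n j - base n i))]).
have mV : measurable V.
  apply: bigcup_measurable => n _; apply: bigcup_measurable => i _.
  exact: measurable_level.
have mH : measurable H.
  apply: bigcup_measurable => n _; apply: bigcup_measurable => i _.
  apply: bigcup_measurable => j _; apply: measurableI; first exact: measurable_level.
  exact: measurable_preimage_shift.
have [N [mN N0 regN]] := ae_regular.
pose Z := V `\` H `\` N.
have mZ : measurable Z by do 2![apply: measurableD => //].
have Zreg x : Z x -> regular_point x.
  move=> [[[n _ [i /= ih xi]] _] nNx]; apply: contrapT => nreg; apply: nNx.
  apply: regN => /= /(_ _)/nreg; apply; exact: (level_in_space spP ih xi).
have Z0 : mu Z = 0.
  apply/eqP; rewrite -measure_le0 leNgt; apply/negP => Zpos.
  have [m1 m1P] := level_density mZ Zpos Zreg.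
  have [m2 m2P] := level_density mA A0 Areg.
  pose n := maxn m1 m2.
  have [i ih Zi] := m1P n (leq_maxl _ _).
  have [j jh Aj] := m2P n (leq_maxr _ _).
  pose Zj := [set x | (Z `&` level n i) (x + (base n i - base n j))].
  have mZi : measurable (Z `&` level n i).
    by apply: measurableI => //; exact: measurable_level.
  have mZj : measurable Zj by exact: measurable_preimage_shift.
  have mAj : measurable (A `&` level n j).
    by apply: measurableI => //; exact: measurable_level.
  have dis : [disjoint Zj & A `&` level n j].
    apply/disj_setPS => y [[[[_ nH] _] yi] [Ay yj]]; apply: nH.
    exists n => //; exists i => //; exists j => //; split=> //=.
    by rewrite (_ : _ + _ = y) //; ring.
  have sub : Zj `|` (A `&` level n j) `<=` level n j.
    move=> y [[_ yi]|[]//]; have := level_shift j yi.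
    by rewrite (_ : _ + _ = y) //; ring.
  have : (mu (Zj `|` (A `&` level n j)) <= mu (level n j))%E.
    apply: le_measure; rewrite ?inE //; first exact: measurableU.
    exact: measurable_level.
  rewrite leNgt => /negP; apply.
  rewrite measureU //; last by apply/eqP; rewrite -disj_set2E.
  rewrite [ltLHS]lebesgue_measure_level.
  rewrite (_ : width n = width n / 2 + width n / 2); last by lra.
  rewrite EFinD; apply: lteD => //.
  by rewrite [ltRHS](_ : _ = mu (Z `&` level n i)) //; exact: lebesgue_measure_shift.
exists (Z `|` N); split.
- exact: measurableU.
- by rewrite measureU0.
move=> x /= /not_implyP[xreg nhit].
have [Nx|nNx] := pselect (N x); [by right|left; split => //].
have [m mP] := regular_deep xreg 0%N; have [i [_ ih xi]] := mP _ (leqnn m).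
have {}ih : (i < height m)%N by lia.
split; first by exists m => //; exists i.
move=> [n _ [i' /= ih' [j /= jh [xi' Aj]]]]; apply: nhit; exists (j%:Z - i'%:Z).
by rewrite (regular_orbit xreg ih' jh).
Qed.

(** * The growth rate *)

Lemma unit_interval_level : unit_itv = level 1 0.
Proof. by rewrite /Defs.level /Defs.base /= width1 add0r. Qed.

(** Removing the null set where P fails from A leaves a set of positive measure,
which [ae_orbit_hits] shows to be visited by almost every orbit. *)
Lemma ae_orbit_hits_ae (A : set R) (P : R -> Prop) : measurable A ->
  A `<=` rank_one_space c s -> (0 < mu A)%E -> {ae mu, forall x, P x} ->
  {ae mu, forall x, rank_one_space c s x -> regular_point x /\
    exists k : int, let y := iterz T T' k x in [/\ A y, regular_point y & P y]}.
Proof.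
move=> mA AX A0 /ae_null_set[N1 [mN1 N10 PN1]].
have [N2 [mN2 N20 regN2]] := ae_null_set ae_regular.
pose A' := A `\` (N1 `|` N2).
have mA' : measurable A' by apply: measurableD => //; exact: measurableU.
have A'P y : A' y -> [/\ A y, regular_point y & P y].
  move=> [Ay nNy]; split => //; last by apply: PN1 => Ny; apply: nNy; left.
  by apply: regN2 (AX _ Ay) => Ny; apply: nNy; right.
have A'0 : (0 < mu A')%E.
  rewrite measure_gt0; apply/negP => /eqP A'0.
  have nA' : {ae mu, forall x, ~ A' x} by exists A'; split=> // x /= /contrapT.
  have [x Ax [nA'x nNx]] : exists2 x, A x & ~ A' x /\ ~ (N1 `|` N2) x.
    apply: ae_exists => //; apply: filter_app nA'; move: N10 N20.
    by apply: filterS2 => x nN1 nN2 nA'x; split => // -[].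
  by apply: nA'x.
have A'reg y : A' y -> regular_point y by move=> /A'P[].
have := ae_orbit_hits mA' A'0 A'reg; have := ae_regular.
apply: filterS2 => x xreg xhit xX; split; first exact: xreg.
by have [k /A'P ?] := xhit (xreg xX); exists k.
Qed.

Lemma height_bracket N : (1 <= N)%N ->
  exists n, [/\ (1 <= n)%N, (height n <= N)%N & (N < height n.+1)%N].
Proof.
move=> N1; pose P n := (1 <= n)%N && (height n <= N)%N.
have exP : exists n, P n by exists 1%N; rewrite /P height1.
have ubP n : P n -> (n <= N)%N.
  by case: n => [//|n] /andP[_ hN]; exact: leq_trans (height_gt n) hN.
case: (ex_maxnP exP ubP) => n /andP[n1 hn] nmax; exists n; split => //.
rewrite ltnNge; apply/negP => hn1; have := nmax n.+1.
by rewrite /P hn1 ltnn => /(_ isT).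
Qed.

Section asymptotics.
Variable C : nat.
Hypothesis c_le : forall n, (1 <= n)%N -> (c n <= C)%N.
Variable stage : nat -> nat.
Hypothesis stageP : forall N, (1 <= N)%N ->
  [/\ (1 <= stage N)%N, (height (stage N) <= N)%N & (N < height (stage N).+1)%N].

Lemma cprodS_le n : (cprod c n.+1 <= C * cprod c n)%N.
Proof. by rewrite cprodS mulnC leq_mul2r c_le // orbT. Qed.

Lemma stage_ge m : (1 <= m)%N -> \forall N \near \oo, (m <= stage N)%N.
Proof.
move=> m1; near=> N; have Nm : (height m <= N)%N by near: N; exact: nbhs_infty_ge.
have N1 : (1 <= N)%N by near: N; exact: nbhs_infty_ge.
have [_ _ NS] := stageP N1; rewrite leqNgt; apply/negP => lt.
have := height_leq (isT : (1 <= (stage N).+1)%N) lt; lia.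
Unshelve. all: by end_near. Qed.

(** Almost every orbit contains a point y of A at which the sums of 1_(0, 1) are
dominated by those of 1_A, and a point z of (0, 1) at which the sums of 1_A are
dominated by those of 1_(0, 1). Passing from x to y or z changes N by a bounded
amount, hence the stage by at most one when N is large, because heights at
least double; each change of stage costs a factor C. *)
Lemma ae_symmetric_sum_asymp (A : set R) : measurable A ->
  A `<=` rank_one_space c s -> (0 < mu A)%E -> (mu A < +oo)%E ->
  {ae mu, forall x, rank_one_space c s x ->
    asymp (fun N => symmetric_sum T T' N (\1_A : R -> R) x)
          (fun N => (cprod c (stage N).-1)%:R)}.
Proof.
move=> mA AX A0 Aoo; pose J := unit_itv.
have mJ : measurable J by exact: measurable_itv.
have JX : J `<=` rank_one_space c s.
  by rewrite /J unit_interval_level; apply: (level_in_space spP).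
have muJ : mu J = 1%E by rewrite /J unit_interval_level lebesgue_measure_level width1.
have J0 : (0 < mu J)%E by rewrite muJ.
have Joo : (mu J < +oo)%E by rewrite muJ ltry.
have := ae_orbit_hits_ae mJ JX J0 (ae_symmetric_sum_dominated mA mJ Aoo).
have := ae_orbit_hits_ae mA AX A0 (ae_symmetric_sum_dominated mJ mA Joo).
apply: filterS2 => x + + xX.
move=> /(_ xX)[xreg [k [Ay yreg yP]]] /(_ xX)[_ [l [Jz zreg zP]]].
set y := iterz T T' k x in Ay yreg yP; set z := iterz T T' l x in Jz zreg zP.
have [lam lam0 {}yP] := yP yreg Ay; have [nu nu0 {}zP] := zP zreg Jz.
have f0 : forall w, 0 <= (\1_A : R -> R) w by [].
have C2 : (2 <= C)%N by exact: leq_trans (c_ge2 (leqnn 1)) (c_le (leqnn 1)).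
have CR : 0 < C%:R :> R by rewrite ltr0n; lia.
pose a N : R := (cprod c (stage N).-1)%:R.
have a0 N : 0 < a N by rewrite ltr0n cprod_gt0.
have [m mP] := regular_deep yreg 0%N.
(* Visits of y to (0, 1) are counted in the tower preceding stage N, whose
   height is at most N - |k|. *)
have low : \forall N \near \oo,
    a N <= lam * C%:R * symmetric_sum T T' N (\1_A : R -> R) x.
  near=> N; have N1 : (1 <= N)%N by near: N; exact: nbhs_infty_ge.
  have : (m + `|k| + 3 <= stage N)%N by near: N; apply: stage_ge; lia.
  have [_ + _] := stageP N1; rewrite /a; case: (stage N) => [|[|n]]; try lia.
  move=> hN mn; have [|i [_ ih yi]] := mP n.+1; first by lia.
  have kh : (`|k| <= height n.+1)%N by have := height_gt n; lia.
  have h2 := @height_double n.+1 isT.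
  have kN : (0 < N - `|k|)%N by lia.
  have [+ _] := symmetric_sum_orbit f0 xreg yreg (erefl : y = iterz T T' k x) kN.
  rewrite subnK; last by lia.
  move=> /(ler_wpM2l (ltW lam0)); move: (yP _ kN) => /le_trans/[apply].
  have yJ : (cprod c n)%:R <= symmetric_sum T T' (N - `|k|) (\1_J : R -> R) y.
    by apply: (@symmetric_sum_unit_ge _ n.+1 i) => //; lia.
  move=> /(le_trans yJ) /(ler_wpM2l (ltW CR)); rewrite mulrA (mulrC C%:R lam).
  by apply: le_trans; rewrite -natrM ler_nat cprodS_le.
(* Visits of z to (0, 1) are counted in the tower two stages after stage N,
   whose height exceeds N + |l|. *)
have upp : \forall N \near \oo,
    symmetric_sum T T' N (\1_A : R -> R) x <= nu * (4 * C%:R * C%:R) * a N.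
  near=> N; have N1 : (1 <= N)%N by near: N; exact: nbhs_infty_ge.
  have : (`|l| + 1 <= stage N)%N by near: N; apply: stage_ge; lia.
  have [_ _ +] := stageP N1; rewrite /a; case: (stage N) => [|n]; first by lia.
  move=> hN mn; have h2 := @height_double n.+2 isT.
  have lh : (`|l| <= height n.+2)%N by have := height_gt n.+1; lia.
  have [_ +] := symmetric_sum_orbit f0 xreg zreg (erefl : z = iterz T T' l x) N1.
  move=> /le_trans; apply; have lN : (0 < N + `|l|)%N by lia.
  apply: le_trans (zP _ lN) _; rewrite -mulrA ler_wpM2l ?(ltW nu0) //.
  apply: le_trans (@symmetric_sum_unit_le _ n.+3 _ zreg _ _ _) _ => //; first by lia.
  rewrite -!natrM ler_nat /=; have := cprodS_le n; have := cprodS_le n.+1.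
  by nia.
split.
- near=> N.
  have : a N <= lam * C%:R * symmetric_sum T T' N (\1_A : R -> R) x.
    by near: N; exact: low.
  by move=> /(lt_le_trans (a0 N)); rewrite pmulr_rgt0 // mulr_gt0.
- by apply: nearW => N; exact: a0.
- pose M := 1 + lam * C%:R + nu * (4 * C%:R * C%:R).
  have p1 : 0 < lam * C%:R by exact: mulr_gt0.
  have p2 : 0 < nu * (4 * C%:R * C%:R) by rewrite !mulr_gt0.
  exists M; first by rewrite /M; lra.
  have M0 : 0 < M by rewrite /M; lra.
  near=> N; rewrite -/(a N); have aN := a0 N.
  have : symmetric_sum T T' N (\1_A : R -> R) x <= nu * (4 * C%:R * C%:R) * a N.
    by near: N; exact: upp.
  have : a N <= lam * C%:R * symmetric_sum T T' N (\1_A : R -> R) x.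
    by near: N; exact: low.
  set S := symmetric_sum _ _ _ _ _ => low_N upp_N.
  have S0 : 0 < S by rewrite -(pmulr_rgt0 S p1) (lt_le_trans aN).
  apply/andP; split.
    rewrite ltr_pdivlMr // mulrC ltr_pdivrMr //; apply: le_lt_trans low_N _.
    by rewrite mulrC ltr_pM2l // /M; lra.
  rewrite ltr_pdivrMr //; apply: le_lt_trans upp_N _.
  by rewrite ltr_pM2r // /M; lra.
Unshelve. all: by end_near. Qed.

End asymptotics.
End tower.

Theorem theorem3 (R : realType) (c : nat -> nat) (s : nat -> nat -> nat)
    (T T' : R -> R)
    (hc : forall n : nat, (1 <= n)%N -> (2 <= c n)%N)
    (hT : rank_one_transformation c s T T')
    (hsup : (ereal_sup [set ((c n)%:R : R)%:E | n in [set n : nat | (1 <= n)%N]]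
             < +oo)%E) :
  exists a : nat -> R,
    (forall n : nat, (1 <= n)%N -> 0 < a n) /\
    forall A : set R, measurable A -> A `<=` rank_one_space c s ->
      (0 < @lebesgue_measure R A)%E -> (@lebesgue_measure R A < +oo)%E ->
      {ae @lebesgue_measure R, forall x, rank_one_space c s x ->
        asymp (fun n : nat => symmetric_sum T T' n (\1_A : R -> R) x) a}.
Proof.
case: hT => sp TP; have spP := spacersP TP.
have [C cC] : exists C, forall n, (1 <= n)%N -> (c n <= C)%N.
  set S := ereal_sup _ in hsup.
  have cS n : (1 <= n)%N -> (((c n)%:R : R)%:E <= S)%E.
    by move=> n1; apply: ereal_sup_ubound; exists n.
  case: S hsup cS => [r _ cS|//|_ /(_ 1%N isT)]; last by rewrite leNgt ltNyr.
  exists (Num.truncn r) => n n1; rewrite -ltnS -(ltr_nat R).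
  apply: (@le_lt_trans _ _ r); first by rewrite -lee_fin; exact: cS.
  by rewrite truncnS_gt.
have /choice[stage stageP] : forall N, exists n, (1 <= N)%N ->
    [/\ (1 <= n)%N, (height c sp n <= N)%N & (N < height c sp n.+1)%N].
  move=> [|N]; first by exists 0%N.
  by have [n nP] := height_bracket sp hc (isT : (1 <= N.+1)%N); exists n.
exists (fun N => (cprod c (stage N).-1)%:R); split.
  by move=> N _; rewrite ltr0n cprod_gt0.
move=> A mA AX A0 Aoo.
exact: (ae_symmetric_sum_asymp hc spP TP cC stageP mA AX A0 Aoo).
Qed.
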